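(* Let $(E,\leqslant,\mathfrak{c})$ be an enriched qoset and let $\mathfrak{s}$ be a closure operator on $E$ that absorbs $\sim$. Let $A\subseteq E$ and $x\in E$. Then the following conditions are equivalent: (1) $x\in\mathrm{ex}_{\mathfrak{c}*\mathfrak{s}}A$; (2) $x\in\mathrm{ex}_{\mathfrak{c}}(A\setminus V)$ for some $\mathfrak{s}$-closed subset $V$ of $E$. Moreover, if $\mathfrak{s}$ is preinductive, then one can choose $V$ to be an $\mathfrak{s}$-copoint of $x$ in (2).
   Context: A qoset $(E,\leqslant)$ is a set with a reflexive transitive relation; $x\sim y$ means $x\leqslant y$ and $y\leqslant x$; $[x]$ is the $\sim$-class of $x$ and $[A]=\bigcup_{a\in A}[a]$. $\downarrow A=\{x:\exists a\in A,\,x\leqslant a\}$. A preclosure operator on $E$ is a map $\mathfrak{c}:2^E\to2^E$ with $A\subseteq\mathfrak{c}(A)\subseteq\mathfrak{c}(B)$ whenever $A\subseteq B$; it is a closure operator if moreover $\mathfrak{c}(\mathfrak{c}(A))=\mathfrak{c}(A)$ for all $A$; $A$ is $\mathfrak{c}$-closed if $\mathfrak{c}(A)=A$. An enriched qoset $(E,\leqslant,\mathfrak{c})$ is a qoset with a preclosure operator such that $\downarrow\mathfrak{c}(A)=\mathfrak{c}(A)$ for all $A\subseteq E$. A preclosure operator $\mathfrak{s}$ absorbs $\sim$ if $[\mathfrak{s}(A)]=\mathfrak{s}(A)=\mathfrak{s}([A])$ for all $A\subseteq E$. The convolution product is $(\mathfrak{c}*\mathfrak{s})(A)=\bigcap_{B\subseteq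 E}\big(\mathfrak{c}(A\cap B)\cup\mathfrak{s}(A\setminus B)\big)$. For a preclosure operator $\mathfrak{t}$ on $E$ and $A\subseteq E$, $\mathrm{ex}_{\mathfrak{t}}A=\{x\in A:x\notin\mathfrak{t}(A\setminus[x])\}$. An $\mathfrak{s}$-copoint of $x$ is an inclusion-maximal element of $\{V\subseteq E:V\ \mathfrak{s}\text{-closed},\ x\notin V\}$. $\mathfrak{s}$ is preinductive if, for every $x\in E$, every $\mathfrak{s}$-closed set not containing $x$ is contained in an $\mathfrak{s}$-copoint of $x$. *)

(* Defs.v *)
(* Subsets of E are elements of [set E], and a
   qoset is a [preorderType] (reflexive transitive [<=], not necessarily
   antisymmetric).  Its order is boolean-valued; over the classical logic of
   [boolp] this is no restriction on the relation nor on the carrier. *)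
From mathcomp Require Import all_boot all_order.
From mathcomp Require Import boolp classical_sets.

Set Implicit Arguments.
Unset Strict Implicit.
Unset Printing Implicit Defensive.

Local Open Scope order_scope.
Local Open Scope classical_set_scope.

Section Qoset.
Context {d : Order.disp_t} {E : preorderType d}.
Implicit Types (x y : E) (A : set E).

Definition qequiv x y : Prop := x <= y /\ y <= x.

Definition qclass x : set E := [set y | qequiv x y].

Definition qsat A : set E := \bigcup_(a in A) qclass a.

(* [classical_sets.down] is the same set, but requires antisymmetry. *)
Definition downset A : set E := [set x | exists2 a, A a & x <= a].

End Qoset.

Section Preclosure.
Context {E : Type}.
Implicit Types (c s : set E -> set E) (A V : set E) (x : E).

Definition preclosure_operator c : Prop :=
  forall A B, A `<=` B -> A `<=` c A /\ c A `<=` c B.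

Definition closure_operator c : Prop :=
  preclosure_operator c /\ forall A, c (c A) = c A.

Definition closed_for c A : Prop := c A = A.

Definition convolution c s : set E -> set E :=
  fun A => \bigcap_(B in [set: set E]) (c (A `&` B) `|` s (A `\` B)).

Definition copoint s x V : Prop :=
  [/\ closed_for s V, ~ V x &
      forall W, closed_for s W -> ~ W x -> V `<=` W -> W = V].

Definition preinductive s : Prop :=
  forall x V, closed_for s V -> ~ V x -> exists2 W, copoint s x W & V `<=` W.

End Preclosure.

Section EnrichedQoset.
Context {d : Order.disp_t} {E : preorderType d}.
Implicit Types (c s t : set E -> set E) (A : set E).

Definition enriched_qoset c : Prop :=
  preclosure_operator c /\ forall A, downset (c A) = c A.

Definition absorbs_equiv s : Prop :=
  forall A, qsat (s A) = s A /\ s A = s (qsat A).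

Definition extreme_points t A : set E := [set x | A x /\ ~ t (A `\` qclass x) x].

End EnrichedQoset.

(* Main.v *)
Require Import Defs.
From mathcomp Require Import all_boot all_order.
From mathcomp Require Import boolp classical_sets.

Local Open Scope classical_set_scope.

(** The intersection defining the convolution product may be taken over the
    complements of [s]-closed sets only.  If [B] witnesses that [x] is outside
    [convolution c s D], then so does the complement of [V := s (D `\` B)],
    which is closed because [s] is idempotent: passing from [B] to that
    complement shrinks the argument of [c] and does not enlarge the value
    of [s].  Hence [x] is outside the convolution exactly when some [s]-closed
    [V] avoids [x] and satisfies [~ c (D `\` V) x]
    ([not_convolutionP]).  For [D := A `\` qclass x], since removing [V]
    and removing [qclass x] commute, this says that [x] is extreme in
    [A `\` V] ([extreme_points_setDP]).

    The condition on [V] is inherited by every larger [s]-closed set that still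
    avoids [x], because [c] is monotone.  When [s] is preinductive, [V] can
    therefore be enlarged to a copoint of [x]. *)

Lemma preclosure_sub (E : Type) (c : set E -> set E) (A : set E) :
  preclosure_operator c -> A `<=` c A.
Proof. by move=> hc; case: (hc A A). Qed.

Lemma preclosure_mono (E : Type) (c : set E -> set E) (A B : set E) :
  preclosure_operator c -> A `<=` B -> c A `<=` c B.
Proof. by move=> hc /hc[]. Qed.

Lemma not_convolutionP (E : Type) (c s : set E -> set E) (D : set E) (x : E) :
  preclosure_operator c -> closure_operator s ->
  ~ convolution c s D x <->
    exists V : set E, [/\ closed_for s V, ~ V x & ~ c (D `\` V) x].
Proof.
move=> hc [hs sK]; split.
- rewrite /convolution /bigcap /= => /existsNP[B] /not_implyP[_].
  move=> /not_orP[ncx nsx].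
  exists (s (D `\` B)); split => //.
  apply: contra_not ncx; apply: preclosure_mono hc _ _ => y [Dy nVy].
  split=> //; apply: contrapT => nBy.
  by apply: nVy; apply: preclosure_sub hs _ _.
- move=> [V [Vcl nVx ncx]] /(_ (~` V) I) [|].
    by rewrite -setDE.
  rewrite setDE setCK => sx; apply: nVx; rewrite -Vcl.
  by apply: preclosure_mono hs _ _ sx => y [].
Qed.

Lemma extreme_points_setDP (d : Order.disp_t) (E : preorderType d)
    (c : set E -> set E) (A V : set E) (x : E) :
  extreme_points c (A `\` V) x <->
    [/\ A x, ~ V x & ~ c ((A `\` qclass x) `\` V) x].
Proof.
rewrite /extreme_points /= !setDE setIAC.
by split=> [[[]]|[]].
Qed.

Lemma extreme_points_convolutionP (d : Order.disp_t) (E : preorderType d)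
    (c s : set E -> set E) (A : set E) (x : E) :
  preclosure_operator c -> closure_operator s ->
  extreme_points (convolution c s) A x <->
    exists V : set E, closed_for s V /\ extreme_points c (A `\` V) x.
Proof.
move=> hc hs; split.
- move=> [Ax /(not_convolutionP _ _ _ _ _ hc hs)[V [Vcl nVx ncx]]].
  by exists V; split=> //; apply/extreme_points_setDP.
- move=> [V [Vcl /extreme_points_setDP[Ax nVx ncx]]].
  by split=> //; apply/(not_convolutionP _ _ _ _ _ hc hs); exists V.
Qed.

(** Enlarging the removed set preserves extremality of a point outside it:
    this is what allows a closed set to be replaced by a copoint above it. *)
Lemma extreme_points_setDS (d : Order.disp_t) (E : preorderType d)
    (c : set E -> set E) (A V W : set E) (x : E) :
  preclosure_operator c -> V `<=` W -> ~ W x ->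
  extreme_points c (A `\` V) x -> extreme_points c (A `\` W) x.
Proof.
move=> hc VW nWx /extreme_points_setDP[Ax _ ncx].
apply/extreme_points_setDP; split=> //.
by apply: contra_not ncx; apply: preclosure_mono hc _ _; apply: setDS.
Qed.

Theorem proposition6p12 (d : Order.disp_t) (E : preorderType d)
    (c s : set E -> set E) (hc : enriched_qoset c)
    (hs : closure_operator s) (hsabs : absorbs_equiv s)
    (A : set E) (x : E) :
  (extreme_points (convolution c s) A x <->
     exists V : set E, closed_for s V /\ extreme_points c (A `\` V) x) /\
  (preinductive s ->
     (extreme_points (convolution c s) A x <->
        exists V : set E, copoint s x V /\ extreme_points c (A `\` V) x)).
Proof.
have [hpc _] := hc.
have convP := extreme_points_convolutionP _ _ _ _ A x hpc hs.
split=> // hind; split.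
- move=> /convP[V [Vcl exV]].
  have /extreme_points_setDP[_ nVx _] := exV.
  have [W Wcop VW] := hind x V Vcl nVx.
  have [_ nWx _] := Wcop.
  by exists W; split=> //; apply: extreme_points_setDS VW nWx exV.
- by move=> [V [[Vcl _ _] exV]]; apply/convP; exists V.
Qed.
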